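(* Let $G$ be a graph on $n$ vertices with Lanzhou eigenvalues $\lambda_1\geq\cdots\geq\lambda_n$, let $k$ be the number of positive Lanzhou eigenvalues of $G$ (counted with multiplicity), and let $\|A_{Lz}(G)\|_F$ denote the Frobenius norm of $A_{Lz}(G)$. Then $$S(A_{Lz}(G))\geq \lambda_1+\sqrt{\frac{\|A_{Lz}(G)\|_F^2-k\lambda_1^2}{n-k}}.$$
   Context: Graphs are finite, simple and undirected. For a graph $G$ on $n$ vertices, $d_G(u)$ is the degree of $u$ in $G$ and $d_{\overline{G}}(u)=n-1-d_G(u)$ is its degree in the complement $\overline{G}$. The Lanzhou matrix $A_{Lz}(G)$ is the real symmetric $n\times n$ matrix indexed by vertices whose $(u,v)$ entry is $d_G(u)d_{\overline{G}}(u)+d_G(v)d_{\overline{G}}(v)$ if $u$ and $v$ are adjacent in $G$, and $0$ otherwise. Its eigenvalues $\lambda_1\geq\cdots\geq\lambda_n$ are the Lanzhou eigenvalues of $G$. The spread is $S(A_{Lz}(G))=\lambda_1-\lambda_n$. The Frobenius norm is the square root of the sum of the squares of all entries. *)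

(* Defs.v *)
(* The reals are an arbitrary real closed field R, which covers
   in particular the field of real numbers. *)
From HB Require Import structures.
From mathcomp Require Import all_boot all_order all_algebra.
From mathcomp Require Import complex.
Set Implicit Arguments.
Unset Strict Implicit.
Unset Printing Implicit Defensive.

Import Order.TTheory GRing.Theory Num.Theory.

Local Open Scope ring_scope.

Definition simple_graph (n : nat) (G : rel 'I_n) : Prop :=
  symmetric G /\ irreflexive G.

Definition complement (n : nat) (G : rel 'I_n) : rel 'I_n :=
  [rel u v | (u != v) && ~~ G u v].

Definition degree (n : nat) (G : rel 'I_n) (u : 'I_n) : nat :=
  #|[set v | G u v]|.

Lemma degree_complement (n : nat) (G : rel 'I_n) (u : 'I_n) :
  simple_graph G -> degree (complement G) u = (n - 1 - degree G u)%N.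
Proof.
case=> _ irrG; rewrite /degree.
have -> : [set v | complement G u v] = ~: (u |: [set v | G u v]).
  by apply/setP=> v; rewrite !inE negb_or eq_sym.
have := cardsC (u |: [set v | G u v]); rewrite cardsU1 inE irrG card_ord /=.
by move=> cardV; rewrite -subnDA -[X in (X - _)%N]cardV addKn.
Qed.

Definition lanzhou_mx (R : rcfType) (n : nat) (G : rel 'I_n) : 'M[R]_n :=
  \matrix_(u, v)
    if G u v then
      (degree G u * degree (complement G) u
       + degree G v * degree (complement G) v)%:R
    else 0.

Lemma lanzhou_mx_sym (R : rcfType) (n : nat) (G : rel 'I_n) :
  simple_graph G -> (lanzhou_mx R G)^T = lanzhou_mx R G.
Proof.
by case=> symG _; apply/matrixP=> u v; rewrite !mxE symG [X in X%:R]addnC.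
Qed.

Definition frobenius_norm (R : rcfType) (m n : nat) (A : 'M[R]_(m, n)) : R :=
  Num.sqrt (\sum_i \sum_j A i j ^+ 2).

(* [lam] lists all n eigenvalues of [A], with multiplicity, in nonincreasing
   order: lambda_i of the usual 1-based numbering is lam`_(i - 1). *)
Definition ordered_eigenvalues (R : rcfType) (n : nat) (A : 'M[R]_n)
    (lam : n.-tuple R) : Prop :=
  sorted >=%R lam /\ char_poly A = \prod_(x <- lam) ('X - x%:P).

Lemma ordered_eigenvalues_uniq (R : rcfType) (n : nat) (A : 'M[R]_n)
    (lam mu : n.-tuple R) :
  ordered_eigenvalues A lam -> ordered_eigenvalues A mu -> lam = mu.
Proof.
move=> [slam dlam] [smu dmu]; apply/val_inj/(sorted_eq _ _ slam smu).
- exact: ge_trans.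
- exact: ge_anti.
- by apply: prod_XsubC_eq; rewrite -dlam dmu.
Qed.

Lemma char_poly_conj (F : fieldType) n (P D : 'M[F]_n) : P \in unitmx ->
  char_poly (invmx P *m D *m P) = char_poly D.
Proof.
move=> uP; rewrite /char_poly.
have E : char_poly_mx (invmx P *m D *m P) =
   map_mx polyC (invmx P) *m char_poly_mx D *m map_mx polyC P.
  rewrite /char_poly_mx !map_mxM mulmxBr mulmxBl; congr (_ - _).
  by rewrite mul_mx_scalar -scalemxAl -map_mxM mulVmx // map_mx1 scalemx1.
rewrite E !det_mulmx mulrC mulrA -det_mulmx -map_mxM mulmxV //.
by rewrite map_mx1 det1 mul1r.
Qed.

Lemma ordered_eigenvalues_exist (R : rcfType) (n : nat) (A : 'M[R]_n) :
  A^T = A -> exists lam : n.-tuple R, ordered_eigenvalues A lam.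
Proof.
move=> symA; pose C : numClosedFieldType := R[i].
pose toC : {rmorphism R -> C} := real_complex R.
have toCR x : toC x \is Num.real by apply/complex_realP; exists x.
pose B : 'M[C]_n := map_mx toC A.
have hermB : B \is hermsymmx.
  apply/is_hermitianmxP; rewrite expr0 scale1r; apply/matrixP=> i j.
  rewrite !mxE -[in LHS]symA mxE; apply/esym/CrealP; exact: toCR.
have /mxOverP realD := hermitian_spectral_diag_real hermB.
have /hermitian_normalmx/orthomx_spectralP defB := hermB.
have cB : char_poly B = \prod_(i < n) ('X - (spectral_diag B 0 i)%:P).
  rewrite {1}defB char_poly_conj ?spectral_unit // char_poly_trig ?diag_mx_is_trig //.
  by apply: eq_bigr => i _; rewrite !mxE eqxx.
pose d i := complex.Re (spectral_diag B 0 i).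
have dE i : toC (d i) = spectral_diag B 0 i by exact: RRe_real.
pose s := sort >=%R [seq d i | i <- enum 'I_n].
have ss : size s == n by rewrite size_sort size_map size_enum_ord.
exists (Tuple ss); split; first by apply: sort_sorted => x y; exact: le_total.
rewrite (perm_big [seq d i | i <- enum 'I_n]) /=; last by rewrite perm_sort.
rewrite big_map big_enum /=; apply: (map_poly_inj toC).
rewrite map_char_poly cB rmorph_prod; apply: eq_bigr => i _ /=.
by rewrite rmorphB /= map_polyX map_polyC /= -dE.
Qed.

Definition spread (R : rcfType) (n : nat) (lam : n.-tuple R) : R :=
  lam`_0 - lam`_n.-1.

Definition npos_eigenvalues (R : rcfType) (n : nat) (lam : n.-tuple R) : nat :=
  count (fun x : R => 0 < x) lam.

(* Main.v *)
(* The squared Frobenius norm is the sum of the squared eigenvalues. The k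
   positive ones are at most lambda_1 ^ 2 each, the other n - k at most
   lambda_n ^ 2; since the trace vanishes, lambda_n <= 0, so the square root
   is at most |lambda_n| = - lambda_n. *)
Require Import Defs.
From mathcomp Require Import all_boot all_order all_algebra.
Import Order.TTheory GRing.Theory Num.Theory.
Local Open Scope ring_scope.

(* Substituting 'X^2 in [char_poly (A *m A)] gives det(X - A) det(X + A), up to
   sign the product of [char_poly A] with its reflection under X |-> -X. *)
Lemma char_poly_sqr (F : comNzRingType) (n : nat) (A : 'M[F]_n) (s : n.-tuple F) :
  char_poly A = \prod_(x <- s) ('X - x%:P) ->
  char_poly (A *m A) = \prod_(x <- s) ('X - (x ^+ 2)%:P).
Proof.
move=> cA; pose Ap : 'M[{poly F}]_n := map_mx polyC A.
have mapA q (B : 'M[F]_n) : map_mx (comp_poly q) (char_poly_mx B) =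
    q%:M - map_mx polyC B.
  by apply/matrixP=> i j; rewrite !mxE rmorphB rmorphMn /= comp_polyX comp_polyC.
have sqrE : char_poly (A *m A) \Po 'X^2 =
    (-1) ^+ n * (char_poly A * (char_poly A \Po (- 'X))).
  rewrite /char_poly -!det_map_mx !mapA map_mxM -det_mulmx -detZ -/Ap.
  (* The sign [(-1) ^+ n] is absorbed into the determinant as a factor -1 on the matrix, which
     leaves X^2 - A^2 = -(X - A)(-X - A). *)
  congr (\det _); rewrite /char_poly_mx -/Ap mulmxBl !mulmxBr -scalar_mxM.
  rewrite (scalar_mxC (- 'X)) mulrN -expr2 !rmorphN /= mulNmx scaleN1r.
  by rewrite -!opprD opprK addrKA.
have sqrEs : char_poly (A *m A) \Po 'X^2 =
    (\prod_(x <- s) ('X - (x ^+ 2)%:P)) \Po 'X^2.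
  rewrite sqrE cA !rmorph_prod /= -big_split /=.
  (* Distribute [(-1) ^+ n] over the n roots, one sign each: -(X - x)(-X - x) = X^2 - x^2. *)
  rewrite -{1}(size_tuple s) -count_predT -iter_mulr_1 -big_const_seq.
  rewrite -big_split /=.
  apply: eq_bigr => x _.
  rewrite !rmorphB /= !comp_polyX !comp_polyC rmorphXn /=.
  by rewrite mulN1r -mulrN -opprD opprK subr_sqr.
(* Substituting ['X^2] loses nothing: coefficient i reappears at index 2i. *)
apply/polyP=> i; have := congr1 (fun p : {poly F} => p`_(i * 2)) sqrEs.
by rewrite /= !coef_comp_poly_Xn // dvdn_mull // mulnK.
Qed.

(** Vieta: both sides are minus the coefficient of degree n - 1. For n = 0 there is no such
    coefficient, and both sides vanish. *)
Lemma mxtrace_char_poly (F : comNzRingType) (n : nat) (A : 'M[F]_n)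
    (s : seq F) :
  size s = n -> char_poly A = \prod_(x <- s) ('X - x%:P) ->
  \tr A = \sum_(x <- s) x.
Proof.
case: n A => [|n] A sz_s cA.
  by rewrite (size0nil sz_s) big_nil /mxtrace big_ord0.
apply: oppr_inj; rewrite -char_poly_trace // cA -sz_s coefPn_prod_XsubC //.
by rewrite sz_s.
Qed.

(** By symmetry the sum of squared entries is the trace of [A *m A], whose eigenvalues are the
    squares of those of A. *)
Lemma frobenius_norm_eigenvalues {R : rcfType} {n : nat} {A : 'M[R]_n}
    {lam : n.-tuple R} :
  A^T = A -> char_poly A = \prod_(x <- lam) ('X - x%:P) ->
  frobenius_norm A ^+ 2 = \sum_(x <- lam) x ^+ 2.
Proof.
move=> symA cA; rewrite sqr_sqrtr; last first.
  by apply: sumr_ge0 => i _; apply: sumr_ge0 => j _; apply: sqr_ge0.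
have -> : \sum_i \sum_j A i j ^+ 2 = \tr (A *m A).
  rewrite /mxtrace; apply: eq_bigr => i _; rewrite !mxE.
  by apply: eq_bigr => j _; rewrite -{3}symA mxE expr2.
rewrite (@mxtrace_char_poly _ _ _ [seq x ^+ 2 | x <- lam]) ?big_map //.
  by rewrite size_map size_tuple.
exact: char_poly_sqr.
Qed.

Lemma ler_sum_count (R : numDomainType) (I : eqType) (r : seq I) (P : pred I)
    (F : I -> R) (c : R) :
  {in r, forall x, P x -> F x <= c} ->
  \sum_(x <- r | P x) F x <= (count P r)%:R * c.
Proof.
move=> F_le; rewrite mulr_natl -iter_addr_0 -big_const_seq [leLHS]big_seq_cond.
rewrite [leRHS]big_seq_cond; apply: ler_sum => x /andP[].
exact: F_le.
Qed.

Lemma mxtrace_lanzhou (R : rcfType) (n : nat) (G : rel 'I_n) :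
  irreflexive G -> \tr (lanzhou_mx R G) = 0.
Proof. by move=> irrG; apply: big1 => i _; rewrite mxE irrG. Qed.

Theorem theorem26 (R : rcfType) (n : nat) (n_gt0 : (0 < n)%N)
    (G : rel 'I_n) (G_graph : simple_graph G)
    (lam : n.-tuple R)
    (lam_eig : ordered_eigenvalues (lanzhou_mx R G) lam)
    (k : nat) (k_def : k = npos_eigenvalues lam) :
  spread lam >=
    lam`_0 + Num.sqrt ((frobenius_norm (lanzhou_mx R G) ^+ 2
                        - k%:R * lam`_0 ^+ 2) / (n%:R - k%:R)).
Proof.
have [lam_sorted lam_char] := lam_eig; have [_ irrG] := G_graph.
have sz := size_tuple lam; set l0 := lam`_0; set ln := lam`_n.-1.
have bnd x : x \in (lam : seq R) -> ln <= x <= l0.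
  case/(nthP 0) => i; rewrite sz => i_lt <-.
  have mono := sorted_leq_nth (@ge_trans _ R) (@ge_refl _ R) 0 lam_sorted.
  by apply/andP; split; apply: mono; rewrite ?inE ?sz ?prednK //
    -ltnS prednK.
have sum0 : \sum_(x <- lam) x = 0.
  by rewrite -(mxtrace_char_poly _ _ _ _ sz lam_char) mxtrace_lanzhou.
have ln_le0 : ln <= 0.
  (* If the least eigenvalue were positive, the eigenvalues could not sum to the zero trace. *)
  rewrite leNgt; apply/negP => ln_gt0.
  have : n%:R * ln <= \sum_(x <- lam) x.
    rewrite mulr_natl -{1}sz -count_predT -iter_addr_0 -big_const_seq.
    rewrite [leLHS]big_seq [leRHS]big_seq.
    by apply: ler_sum => x /bnd /andP[].
  by rewrite sum0 leNgt mulr_gt0 ?ltr0n.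
have k_le : (k <= n)%N by rewrite k_def -{2}sz count_size.
have frob_le : frobenius_norm (lanzhou_mx R G) ^+ 2 <=
    k%:R * l0 ^+ 2 + (n%:R - k%:R) * ln ^+ 2.
  rewrite (frobenius_norm_eigenvalues (lanzhou_mx_sym R G_graph) lam_char).
  rewrite (bigID (fun x : R => 0 < x)) /= lerD //.
    rewrite k_def; apply: ler_sum_count => x /bnd /andP[_ x_le] x_gt0.
    by rewrite lerXn2r ?nnegrE ?(ltW x_gt0) ?(le_trans (ltW x_gt0)).
  have := count_predC (fun x : R => 0 < x) lam; rewrite sz => n_split.
  rewrite -natrB // -[X in (X - k)%N]n_split k_def addKn.
  apply: ler_sum_count => x /bnd /andP[le_x _]; rewrite -leNgt => x_le0.
  (* Squaring is monotone only on nonnegative numbers, so compare -x with -[ln]. *)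
  by rewrite -sqrrN -[leRHS]sqrrN lerXn2r ?nnegrE ?oppr_ge0 ?lerN2.
(* Write -[ln] as the square root of [ln ^+ 2], so that only the radicands remain to be compared. *)
rewrite /spread lerD2l -/ln -[- ln]ger0_norm ?oppr_ge0 // -sqrtr_sqr sqrrN.
rewrite ler_wsqrtr //; have [k_lt|] := ltnP k n.
  by rewrite ler_pdivrMr ?subr_gt0 ?ltr_nat // lerBlDl [ln ^+ 2 * _]mulrC.
(* For k = n the quotient is x / 0 = 0. *)
by move=> n_le; rewrite (@anti_leq k n) ?k_le // subrr invr0 mulr0 sqr_ge0.
Qed.
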